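(* Let $\mathcal{C}$ be a $k$-linear Reedy category and suppose that $M\in\mathcal{K}^{\mathcal{C}}$ is filtered by standard modules. Then so is any direct summand of $M$.
   Context: $k$ is a field, $\mathcal{K}$ is the category of $k$-vector spaces, and $\mathcal{K}^{\mathcal{C}}$ is the category of left $\mathcal{C}$-modules, i.e. $k$-linear functors $\mathcal{C}\to\mathcal{K}$. A small $k$-linear category $\mathcal{D}$ is called direct (resp. inverse) if $\operatorname{End}_{\mathcal{D}}(c)\cong k$ for every object $c$, and there are an ordinal $\lambda$ and a function $\deg\colon\operatorname{Obj}(\mathcal{D})\to\lambda$ such that every non-zero non-endomorphism $c\to c'$ satisfies $\deg(c)<\deg(c')$ (resp. $\deg(c)>\deg(c')$). A small $k$-linear category $\mathcal{C}$ is called $k$-linear Reedy if there are an ordinal $\lambda$, a function $\deg\colon\operatorname{Obj}(\mathcal{C})\to\lambda$, and two $k$-linear subcategories $\mathcal{C}^+,\mathcal{C}^-$ of $\mathcal{C}$ with the same objects as $\mathcal{C}$, with $\mathcal{C}^+$ direct and $\mathcal{C}^-$ inverse with respect to the same function $\deg$, such that for all objects $c,d$ composition induces a $k$-linear isomorphism $\bigoplus_{e\in\operatorname{Obj}(\mathcal{C})}\mathcal{C}^+(e,d)\otimes_k\mathcal{C}^-(c,e)\cong\mathcal{C}(c,d)$. These data are fixed. For an ordinal $\alpha\le\lambda$ and objects $c,d$, let $\mathcal{I}^{\mathcal{C}}_{<\alpha}(c,d)\subseteq\mathcal{C}(c,d)$ be the image of the composition map $\bigoplus_{\deg(e)<\alpha}\mathcal{C}^+(e,d)\otimes_k\mathcal{C}^-(c,e)\to\mathcal{C}(c,d)$;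 this defines a two-sided ideal of $\mathcal{C}$. For an object $c$ of degree $\alpha$, the standard (left $\mathcal{C}$-)module of $c$ is $\Delta_c:=\mathcal{C}(c,-)/\mathcal{I}^{\mathcal{C}}_{<\alpha}(c,-)$. A module $M$ is filtered by standard modules if there are an ordinal $\sigma$ and a chain of submodules $0=M_0\subseteq M_1\subseteq\cdots\subseteq M_\sigma=M$ indexed by the ordinals $\le\sigma$, with $M_\gamma=\bigcup_{\delta<\gamma}M_\delta$ for limit ordinals $\gamma\le\sigma$ and each $M_{\delta+1}/M_\delta$ ($\delta<\sigma$) isomorphic to $\Delta_c$ for some object $c$ of $\mathcal{C}$. *)

(* Defs.v *)
From HB Require Import structures.
From mathcomp Require Import all_boot all_algebra.
From mathcomp Require Import wochoice.
From mathcomp Require Import boolp classical_sets functions cardinality fsbigop.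
From mathcomp Require Import finmap.

Set Implicit Arguments.
Unset Strict Implicit.
Unset Printing Implicit Defensive.

Import GRing.Theory.
Local Open Scope classical_set_scope.
Local Open Scope quotient_scope.
Local Open Scope ring_scope.

Record subspace (k : fieldType) (V : lmodType k) := Subspace {
  subspace_pred :> {pred V};
  subspace_closed : submod_closed subspace_pred }.

HB.instance Definition _ (k : fieldType) (V : lmodType k) (S : subspace V) :=
  GRing.isSubmodClosed.Build k V (subspace_pred S) (subspace_closed S).

Section SubspaceType.
Variables (k : fieldType) (V : lmodType k) (S : subspace V).

Definition subspace_type := {x : V | x \in subspace_pred S}.

HB.instance Definition _ := SubChoice.on subspace_type.
HB.instance Definition _ := [SubChoice_isSubLmodule of subspace_type by <:].

End SubspaceType.

(* Quotient.quot only carries a zmodule structure; scaling is added here. *)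
Section QuotientSpace.
Variables (k : fieldType) (V : lmodType k) (S : subspace V).

Definition qspace := Quotient.quot (subspace_pred S).

HB.instance Definition _ := GRing.Zmodule.on qspace.

Definition qpi (x : V) : qspace := \pi_(Quotient.quot (subspace_pred S)) x.
Definition qrepr (x : qspace) : V := repr x.

Lemma qreprK : cancel qrepr qpi.
Proof. exact: reprK. Qed.

Lemma qpiP (x y : V) : reflect (qpi x = qpi y) (x - y \in S).
Proof.
rewrite [_ \in _](Quotient.idealrBE (subspace_pred S)); exact: eqP.
Qed.

Lemma qpi_is_zmod_morphism : zmod_morphism qpi.
Proof. exact: raddfB. Qed.

Definition qscale (a : k) (x : qspace) : qspace := qpi (a *: qrepr x).

Lemma qpiZ a x : qpi (a *: x) = qscale a (qpi x).
Proof.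
by apply/qpiP; rewrite -scalerBr rpredZ //; apply/qpiP; rewrite qreprK.
Qed.

Let qpiD x y : qpi (x + y) = qpi x + qpi y.
Proof. exact: raddfD. Qed.

Lemma qscaleA a b x : qscale a (qscale b x) = qscale (a * b) x.
Proof. by rewrite -[x]qreprK -!qpiZ scalerA. Qed.
Lemma qscale1 : left_id 1 qscale.
Proof. by move=> x; rewrite -[x]qreprK -!qpiZ scale1r. Qed.
Lemma qscaleDr : right_distributive qscale +%R.
Proof.
by move=> a x y; rewrite -[x]qreprK -[y]qreprK -qpiD -!qpiZ -qpiD scalerDr.
Qed.
Lemma qscaleDl x : {morph qscale^~ x : a b / a + b}.
Proof. by move=> a b; rewrite -[x]qreprK -!qpiZ -qpiD scalerDl. Qed.

HB.instance Definition _ := GRing.Zmodule_isLmodule.Build k qspace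
  qscaleA qscale1 qscaleDr qscaleDl.

Lemma qpi_is_linear : linear qpi.
Proof. by move=> a x y; rewrite qpiD qpiZ. Qed.

HB.instance Definition _ := GRing.isLinear.Build k V qspace *:%R qpi
  qpi_is_linear.

Section Lift.
Variables (W : lmodType k) (f : {linear V -> W}).
Hypothesis fS : forall x, x \in S -> f x = 0.

Definition qlift_fun of (forall x, x \in S -> f x = 0) := f \o qrepr.

Lemma qlift_funE x : qlift_fun fS (qpi x) = f x.
Proof.
apply/eqP; rewrite -subr_eq0 -linearB fS //; apply/qpiP.
by rewrite qreprK.
Qed.

Lemma qlift_is_linear : linear (qlift_fun fS).
Proof.
move=> a x y; rewrite -[x]qreprK -[y]qreprK -linearP !qlift_funE.
exact: linearP.
Qed.

HB.instance Definition _ := GRing.isLinear.Build k qspace W *:%R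
  (qlift_fun fS) qlift_is_linear.

Definition qlift : {linear qspace -> W} := qlift_fun fS.

End Lift.

End QuotientSpace.

Section Span.
Variables (k : fieldType) (V : lmodType k) (X : set V).

Definition lspan_pred : {pred V} :=
  [pred x | `[< forall S : subspace V, (forall y, X y -> y \in S) -> x \in S >]].

Lemma lspan_closed : submod_closed lspan_pred.
Proof.
split; first by apply/asboolP => S _; exact: rpred0.
move=> a x y /asboolP Hx /asboolP Hy; apply/asboolP => S XS.
by rewrite rpredD ?rpredZ ?Hx ?Hy.
Qed.

Definition lspan := Subspace lspan_closed.

End Span.

Section Image.
Variables (k : fieldType) (V W : lmodType k) (f : {linear V -> W}).

Definition image_pred : {pred W} := [pred y | `[< exists x, y = f x >]].

Lemma image_closed : submod_closed image_pred.
Proof.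
split; first by apply/asboolP; exists 0; rewrite linear0.
move=> a _ _ /asboolP[x ->] /asboolP[y ->]; apply/asboolP.
by exists (a *: x + y); rewrite linearP.
Qed.

Definition image_subspace := Subspace image_closed.

Lemma preimage_closed (S : subspace W) : submod_closed [pred x | f x \in S].
Proof.
split=> [|a x y]; rewrite !inE ?linear0 ?rpred0 // => xS yS.
by rewrite linearP rpredD ?rpredZ.
Qed.

Definition preimage_subspace S := Subspace (preimage_closed S).

End Image.

Section DirectSum.
Variables (k : fieldType) (I : Type) (V : I -> lmodType k).

Record dsum := Dsum {
  dcoef :> forall i, V i;
  dcoef_fin : finite_set [set i | dcoef i != 0] }.

Lemma dsumP (x y : dsum) : (forall i, x i = y i) <-> x = y.
Proof.
split=> [|-> //]; case: x y => [x xf] [y yf] /= xy.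
have {}xy : x = y by apply: functional_extensionality_dep.
by case: y / xy yf => yf; rewrite (Prop_irrelevance xf yf).
Qed.

HB.instance Definition _ := gen_eqMixin dsum.
HB.instance Definition _ := gen_choiceMixin dsum.

Lemma dzero_fin : finite_set [set i | (0 : V i) != 0].
Proof.
by apply: (sub_finite_set (B := set0)) => // i /=; rewrite eqxx.
Qed.

Lemma dopp_fin (x : dsum) : finite_set [set i | - x i != 0].
Proof.
by apply: sub_finite_set (dcoef_fin x) => i /=; rewrite oppr_eq0.
Qed.

Lemma dadd_fin (x y : dsum) : finite_set [set i | x i + y i != 0].
Proof.
apply: (sub_finite_set (B := [set i | x i != 0] `|` [set i | y i != 0])).
  move=> i /= xy0; have [x0|] := eqVneq (x i) 0; last by left.
  by right; rewrite x0 add0r in xy0.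
by rewrite finite_setU; split; apply: dcoef_fin.
Qed.

Lemma dscale_fin a (x : dsum) : finite_set [set i | a *: x i != 0].
Proof.
by apply: sub_finite_set (dcoef_fin x) => i /=; apply: contra_neq => ->;
  rewrite scaler0.
Qed.

Definition dzero := Dsum dzero_fin.
Definition dopp x := Dsum (dopp_fin x).
Definition dadd x y := Dsum (dadd_fin x y).
Definition dscale a x := Dsum (dscale_fin a x).

Lemma daddA : associative dadd.
Proof. by move=> x y z; apply/dsumP => i /=; rewrite addrA. Qed.
Lemma daddC : commutative dadd.
Proof. by move=> x y; apply/dsumP => i /=; rewrite addrC. Qed.
Lemma dadd0 : left_id dzero dadd.
Proof. by move=> x; apply/dsumP => i /=; rewrite add0r. Qed.
Lemma daddN : left_inverse dzero dopp dadd.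
Proof. by move=> x; apply/dsumP => i /=; rewrite addNr. Qed.

HB.instance Definition _ := GRing.isZmodule.Build dsum
  daddA daddC dadd0 daddN.

Lemma dscaleA a b x : dscale a (dscale b x) = dscale (a * b) x.
Proof. by apply/dsumP => i /=; rewrite scalerA. Qed.
Lemma dscale1 : left_id 1 dscale.
Proof. by move=> x; apply/dsumP => i /=; rewrite scale1r. Qed.
Lemma dscaleDr : right_distributive dscale +%R.
Proof. by move=> a x y; apply/dsumP => i /=; rewrite scalerDr. Qed.
Lemma dscaleDl x : {morph dscale^~ x : a b / a + b}.
Proof. by move=> a b; apply/dsumP => i /=; rewrite scalerDl. Qed.

HB.instance Definition _ := GRing.Zmodule_isLmodule.Build k dsum
  dscaleA dscale1 dscaleDr dscaleDl.

Lemma dsumDE (x y : dsum) i : (x + y) i = x i + y i.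
Proof. by []. Qed.
Lemma dsumZE a (x : dsum) i : (a *: x) i = a *: x i.
Proof. by []. Qed.
Lemma dsum0E i : (0 : dsum) i = 0.
Proof. by []. Qed.

Section Single.
Variables (i : I) (v : V i).

Definition dsingle_fun (j : I) : V j :=
  if pselect (i = j) is left e then eq_rect i (fun l => V l : Type) v j e
  else 0.

Lemma dsingle_fin : finite_set [set j | dsingle_fun j != 0].
Proof.
apply: (sub_finite_set (B := [set i])) => // j /=.
by rewrite /dsingle_fun; case: pselect => [//|_]; rewrite eqxx.
Qed.

Definition dsingle := Dsum dsingle_fin.

Lemma dsingleE : dsingle i = v.
Proof.
rewrite /= /dsingle_fun; case: pselect => // e.
by rewrite (Prop_irrelevance e erefl).
Qed.

End Single.

Section Lift.
Variables (W : lmodType k) (f : forall i, {linear V i -> W}).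

Definition dlift_fun (x : dsum) : W := \sum_(i \in [set: {classic I}]) f i (x i).

Lemma dlift_funE (A : {fset {classic I}}) (x : dsum) :
  (forall i, x i != 0 -> (i : {classic I}) \in A) ->
  dlift_fun x = \sum_(i <- A) f (i : I) (x i).
Proof.
move=> xA; apply: (fsbigTE A (fun i : {classic I} => f (i : I) (x i))) => i iA.
have [->|/xA] := eqVneq (x i) 0; first exact: linear0.
by rewrite (negPf iA).
Qed.

Lemma dlift_is_linear : linear dlift_fun.
Proof.
move=> a x y.
pose A : {fset {classic I}} := fset_set
  ([set i : {classic I} | x i != 0] `|` [set i : {classic I} | y i != 0]).
have inA i : (i \in A) = (x i != 0) || (y i != 0).
  rewrite in_fset_set; last by rewrite finite_setU; split; exact: dcoef_fin.
  by apply/idP/orP => [/set_mem|?] //; exact: mem_set.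
rewrite !(@dlift_funE A).
- rewrite scaler_sumr -big_split /=; apply: eq_bigr => i _.
  by rewrite -linearP.
- by move=> i y0; rewrite inA y0 orbT.
- by move=> i x0; rewrite inA x0.
- move=> i; rewrite inA; apply: contraR; rewrite negb_or !negbK.
  by move=> /andP[/eqP x0 /eqP y0]; rewrite dsumDE dsumZE x0 y0 scaler0 addr0.
Qed.

HB.instance Definition _ := GRing.isLinear.Build k dsum W *:%R dlift_fun
  dlift_is_linear.

Definition dlift : {linear dsum -> W} := dlift_fun.

Lemma dlift_single i (v : V i) : dlift (dsingle v) = f i v.
Proof.
rewrite [LHS](@dlift_funE [fset (i : {classic I})]%fset).
  by rewrite big_seq_fset1 dsingleE.
move=> j; rewrite in_fset1 /= /dsingle_fun; case: pselect => [ij _|_].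
  by apply/eqP.
by rewrite eqxx.
Qed.

End Lift.

End DirectSum.

Section Tensor.
Variables (k : fieldType) (A B : lmodType k).

Definition freemod (X : Type) : lmodType k := dsum (fun _ : X => k^o : lmodType k).
Definition fgen (X : Type) (x : X) : freemod X :=
  dsingle (V := fun _ : X => k^o : lmodType k) (i := x) 1.

Definition tensor_rel : set (freemod (A * B)) :=
  [set t | (exists a x y b,
              t = fgen (a *: x + y, b) - (a *: fgen (x, b) + fgen (y, b)))
        \/ (exists a b x y,
              t = fgen (b, a *: x + y) - (a *: fgen (b, x) + fgen (b, y)))].

Definition tensor : lmodType k := qspace (lspan tensor_rel).
Definition tens (a : A) (b : B) : tensor := qpi _ (fgen (a, b)).

Section Lift.
Variables (W : lmodType k) (f : {bilinear A -> B -> W}).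

Definition line (w : W) (a : k^o) : W := a *: w.

Lemma line_is_linear w : linear (line w).
Proof. by move=> a x y; rewrite /line scalerDl scalerA. Qed.

HB.instance Definition _ w := GRing.isLinear.Build k k^o W *:%R (line w)
  (line_is_linear w).

Definition tlift_free : {linear freemod (A * B) -> W} :=
  dlift (fun ab : A * B => line (f ab.1 ab.2)).

Lemma tlift_freeE ab : tlift_free (fgen ab) = f ab.1 ab.2.
Proof. by rewrite /tlift_free dlift_single /= /line scale1r. Qed.

Lemma tlift_subproof x : x \in lspan tensor_rel -> tlift_free x = 0.
Proof.
have kerP : submod_closed [pred x | tlift_free x == 0].
  split=> [|a x1 y]; rewrite !inE ?linear0 // => /eqP x0 /eqP y0.
  by rewrite linearP x0 y0 scaler0 addr0.
move=> /asboolP/(_ (Subspace kerP)) H; apply/eqP/H => y yrel; rewrite inE.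
by case: yrel => -[a [x1 [y1 [b ->]]]]; rewrite linearB linearP !tlift_freeE /=
  ?linearPl ?linearPr subrr.
Qed.

Definition tlift : {linear tensor -> W} := qlift tlift_subproof.

Lemma tliftE a b : tlift (tens a b) = f a b.
Proof. by rewrite [LHS]qlift_funE tlift_freeE. Qed.

End Lift.

End Tensor.

Record lincat (k : fieldType) := Lincat {
  obj :> Type;
  hom : obj -> obj -> lmodType k;
  idm : forall c, hom c c;
  compm : forall c d e, hom d e -> hom c d -> hom c e;
  comp_bilinear : forall c d e, bilinear_for *:%R *:%R (@compm c d e);
  compA : forall c d e l (h : hom e l) (g : hom d e) (f : hom c d),
    compm h (compm g f) = compm (compm h g) f;
  comp1m : forall c d (f : hom c d), compm (idm d) f = f;
  compm1 : forall c d (f : hom c d), compm f (idm c) = f }.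

Arguments hom {k C} c d : rename.
Arguments idm {k C} c : rename.
Arguments compm {k C c d e} g f : rename.

HB.instance Definition _ (k : fieldType) (C : lincat k) (c d e : C) :=
  bilinear_isBilinear.Build k (hom d e) (hom c d) (hom c e) *:%R *:%R
    (@compm k C c d e) (comp_bilinear c d e).

HB.instance Definition _ (k : fieldType) (C : lincat k) (c d e : C)
    (g : hom d e) :=
  GRing.isLinear.Build k (hom c d) (hom c e) *:%R (@compm k C c d e g)
    ((comp_bilinear c d e).2 g).

Record wide_subcat (k : fieldType) (C : lincat k) := WideSubcat {
  shom : forall c d : C, subspace (hom c d);
  shom_id : forall c, idm c \in shom c c;
  shom_comp : forall c d e (g : hom d e) (f : hom c d),
    g \in shom d e -> f \in shom c d -> compm g f \in shom c e }.

Section SubcatLincat.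
Variables (k : fieldType) (C : lincat k) (S : wide_subcat C).

Definition sc_hom (c d : C) : lmodType k := subspace_type (shom S c d).

Definition sc_id (c : C) : sc_hom c c := exist _ (idm c) (shom_id S c).

Definition sc_comp (c d e : C) (g : sc_hom d e) (f : sc_hom c d) : sc_hom c e :=
  exist _ (compm (val g) (val f)) (shom_comp (valP g) (valP f)).

Lemma sc_comp_bilinear c d e : bilinear_for *:%R *:%R (@sc_comp c d e).
Proof.
by split=> f a x y; apply: val_inj; rewrite /= ?linearPl ?linearPr.
Qed.

Lemma sc_compA c d e l (h : sc_hom e l) (g : sc_hom d e) (f : sc_hom c d) :
  sc_comp h (sc_comp g f) = sc_comp (sc_comp h g) f.
Proof. by apply: val_inj; rewrite /= compA. Qed.

Lemma sc_comp1m c d (f : sc_hom c d) : sc_comp (sc_id d) f = f.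
Proof. by apply: val_inj; rewrite /= comp1m. Qed.

Lemma sc_compm1 c d (f : sc_hom c d) : sc_comp f (sc_id c) = f.
Proof. by apply: val_inj; rewrite /= compm1. Qed.

Definition wide_subcat_lincat : lincat k :=
  Lincat sc_comp_bilinear sc_compA sc_comp1m sc_compm1.

End SubcatLincat.

Coercion wide_subcat_lincat : wide_subcat >-> lincat.

(* An ordinal is given by a well-ordered type, whose elements stand for the
   smaller ordinals. *)
Record woType := WoType {
  wo_sort :> Type;
  wo_le : rel wo_sort;
  wo_wellP : well_order wo_le }.

Arguments wo_le {T} x y : rename.

Definition wo_lt (T : woType) (x y : T) : bool := ~~ wo_le y x.

Lemma wo_le_total (T : woType) (x y : T) : wo_le x y || wo_le y x.
Proof.
have [|m [[/asboolP mxy mle] _]] :=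
    wo_wellP (w := T) (A := [pred t | `[< t = x \/ t = y >]]).
  by exists x; apply/asboolP; left.
have mx : wo_le m x by apply: mle; apply/asboolP; left.
have my : wo_le m y by apply: mle; apply/asboolP; right.
by case: mxy => <-; rewrite ?mx ?my ?orbT.
Qed.

Lemma wo_le_anti (T : woType) (x y : T) : wo_le x y -> wo_le y x -> x = y.
Proof.
move=> xy yx; have [|m [_ mU]] := wo_wellP (w := T) (A := [pred t | `[< t = x \/ t = y >]]).
  by exists x; apply/asboolP; left.
have refl t : wo_le t t by have := wo_le_total t t; rewrite orbb.
rewrite -[LHS]mU -?[RHS]mU //; split; try by apply/asboolP; auto.
all: by move=> t /asboolP[->|->].
Qed.

Lemma wo_lt_trans (T : woType) (y x z : T) :
  wo_lt x y -> wo_lt y z -> wo_lt x z.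
Proof.
rewrite /wo_lt => yx zy; apply/negP => zx.
have [xy yz] : wo_le x y /\ wo_le y z.
  by have := wo_le_total x y; have := wo_le_total y z;
     rewrite (negPf yx) (negPf zy) !orbF.
have [|m [[/asboolP[|[|]]-> mle _]]] :=
    wo_wellP (w := T) (A := [pred t | `[< t = x \/ t = y \/ t = z >]]).
- by exists x; apply/asboolP; left.
- have xz : wo_le x z by apply: mle; apply/asboolP; auto.
  by rewrite (wo_le_anti zx xz) xy in zy.
- by rewrite mle // in yx; apply/asboolP; auto.
- by rewrite mle // in zy; apply/asboolP; auto.
Qed.

Definition is_succ (T : woType) (s t : T) : Prop :=
  wo_lt s t /\ forall u, wo_lt s u -> wo_le t u.

Definition is_limit (T : woType) (t : T) : Prop :=
  (exists s, wo_lt s t) /\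
  forall s, wo_lt s t -> exists2 u, wo_lt s u & wo_lt u t.

Definition endo_iso_scalars (k : fieldType) (D : lincat k) (c : D) : Prop :=
  exists f : {linear k^o -> hom c c},
    [/\ bijective f, f 1 = idm c & forall a b : k, f (a * b) = compm (f a) (f b)].

Definition direct_wrt (k : fieldType) (D : lincat k) (lam : woType)
    (deg : D -> lam) : Prop :=
  (forall c : D, endo_iso_scalars c) /\
  (forall (c d : D) (f : hom c d), c <> d -> f <> 0 -> wo_lt (deg c) (deg d)).

Definition inverse_wrt (k : fieldType) (D : lincat k) (lam : woType)
    (deg : D -> lam) : Prop :=
  (forall c : D, endo_iso_scalars c) /\
  (forall (c d : D) (f : hom c d), c <> d -> f <> 0 -> wo_lt (deg d) (deg c)).

Section CompositionMap.
Variables (k : fieldType) (C : lincat k) (Cp Cm : wide_subcat C).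

Definition comp_pm (c d e : C) (g : sc_hom Cp e d) (f : sc_hom Cm c e) :
  hom c d := compm (val g) (val f).

Lemma comp_pm_bilinear c d e : bilinear_for *:%R *:%R (@comp_pm c d e).
Proof. by split=> f a x y; rewrite /comp_pm /= ?linearPl ?linearPr. Qed.

HB.instance Definition _ c d e :=
  bilinear_isBilinear.Build k (sc_hom Cp e d) (sc_hom Cm c e) (hom c d)
    *:%R *:%R (@comp_pm c d e) (comp_pm_bilinear c d e).

(* An arbitrary family of objects e serves both for the sum over all objects
   (e the identity) and for the sum over the objects of degree < alpha. *)
Definition pm_sum (I : Type) (e : I -> C) (c d : C) : lmodType k :=
  dsum (fun i => tensor (sc_hom Cp (e i) d) (sc_hom Cm c (e i))).

Definition pm_comp (I : Type) (e : I -> C) (c d : C) :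
    {linear pm_sum e c d -> hom c d} :=
  dlift (fun i => tlift (@comp_pm c d (e i))).

Lemma pm_comp_single (I : Type) (e : I -> C) (c d : C) i
    (g : sc_hom Cp (e i) d) (f : sc_hom Cm c (e i)) :
  pm_comp e c d (dsingle (V := fun i => tensor (sc_hom Cp (e i) d)
    (sc_hom Cm c (e i))) (tens g f)) = comp_pm g f.
Proof. by rewrite /pm_comp dlift_single tliftE. Qed.

Lemma pm_comp_ind (I : Type) (e : I -> C) (c d : C) (S : subspace (hom c d)) :
  (forall i (g : sc_hom Cp (e i) d) (f : sc_hom Cm c (e i)),
     comp_pm g f \in S) ->
  forall t, pm_comp e c d t \in S.
Proof.
move=> gfS t; apply: rpred_sum => i _; apply: rpred_sum => -[g f] _.
by apply: rpredZ; apply: gfS.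
Qed.

End CompositionMap.

Record reedy (k : fieldType) (C : lincat k) := Reedy {
  rlam : woType;
  rdeg : C -> rlam;
  rplus : wide_subcat C;
  rminus : wide_subcat C;
  rplus_direct : direct_wrt (D := rplus) rdeg;
  rminus_inverse : inverse_wrt (D := rminus) rdeg;
  reedy_bij : forall c d : C,
    bijective (pm_comp rplus rminus (fun e : C => e) c d) }.

(* Left C-modules, i.e. k-linear functors from C to k-vector spaces. *)
Record cmodule (k : fieldType) (C : lincat k) := Cmodule {
  mobj :> C -> lmodType k;
  mact : forall c d, hom c d -> mobj c -> mobj d;
  mact_bilinear : forall c d, bilinear_for *:%R *:%R (@mact c d);
  mact1 : forall c (x : mobj c), mact (idm c) x = x;
  mactM : forall c d e (g : hom d e) (f : hom c d) (x : mobj c),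
    mact (compm g f) x = mact g (mact f x) }.

Arguments mact {k C M c d} f x : rename.

HB.instance Definition _ (k : fieldType) (C : lincat k) (M : cmodule C)
    (c d : C) :=
  bilinear_isBilinear.Build k (hom c d) (M c) (M d) *:%R *:%R
    (@mact k C M c d) (mact_bilinear M c d).

Definition cmod_iso (k : fieldType) (C : lincat k) (M N : cmodule C) : Prop :=
  exists f : forall c, {linear M c -> N c},
    (forall c d (u : hom c d) (x : M c), f d (mact u x) = mact u (f c x)) /\
    (forall c, bijective (f c)).

Record submodule (k : fieldType) (C : lincat k) (M : cmodule C) := Submodule {
  sub_at : forall c, subspace (M c);
  sub_act : forall c d (u : hom c d) (x : M c),
    x \in sub_at c -> mact u x \in sub_at d }.

Section SubModule.
Variables (k : fieldType) (C : lincat k) (M : cmodule C) (P : submodule M).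

Definition sm_obj (c : C) : lmodType k := subspace_type (sub_at P c).

Definition sm_act (c d : C) (u : hom c d) (x : sm_obj c) : sm_obj d :=
  exist _ (mact u (val x)) (sub_act u (valP x)).

Lemma sm_act_bilinear c d : bilinear_for *:%R *:%R (@sm_act c d).
Proof.
by split=> f a x y; apply: val_inj; rewrite /= ?linearPl ?linearPr.
Qed.

Lemma sm_act1 c (x : sm_obj c) : sm_act (idm c) x = x.
Proof. by apply: val_inj; rewrite /= mact1. Qed.

Lemma sm_actM c d e (g : hom d e) (f : hom c d) (x : sm_obj c) :
  sm_act (compm g f) x = sm_act g (sm_act f x).
Proof. by apply: val_inj; rewrite /= mactM. Qed.

Definition submodule_cmod : cmodule C :=
  Cmodule sm_act_bilinear sm_act1 sm_actM.

End SubModule.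

Section QuotientModule.
Variables (k : fieldType) (C : lincat k) (M : cmodule C) (P : submodule M).

Definition qm_obj (c : C) : lmodType k := qspace (sub_at P c).

Definition qm_act (c d : C) (u : hom c d) (x : qm_obj c) : qm_obj d :=
  qpi _ (mact u (qrepr x)).

Lemma qm_actE c d (u : hom c d) (x : M c) :
  qm_act u (qpi (sub_at P c) x) = qpi (sub_at P d) (mact u x).
Proof.
apply/qpiP; rewrite -linearBr; apply: sub_act; apply/qpiP.
by rewrite qreprK.
Qed.

Lemma qm_act_bilinear c d : bilinear_for *:%R *:%R (@qm_act c d).
Proof.
split=> [x|u] a; first by move=> u v; rewrite /qm_act linearPl linearP.
move=> x y; rewrite -[x]qreprK -[y]qreprK -linearP !qm_actE linearPr.
exact: linearP.
Qed.

Lemma qm_act1 c (x : qm_obj c) : qm_act (idm c) x = x.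
Proof. by rewrite /qm_act mact1 qreprK. Qed.

Lemma qm_actM c d e (g : hom d e) (f : hom c d) (x : qm_obj c) :
  qm_act (compm g f) x = qm_act g (qm_act f x).
Proof. by rewrite -[x]qreprK !qm_actE mactM. Qed.

Definition quotient_cmod : cmodule C :=
  Cmodule qm_act_bilinear qm_act1 qm_actM.

End QuotientModule.

(* The subquotient P / Q; the definition is used only for Q contained in P. *)
Section Subquotient.
Variables (k : fieldType) (C : lincat k) (M : cmodule C) (P Q : submodule M).

Definition sq_sub (c : C) : subspace (submodule_cmod P c) :=
  preimage_subspace (\val : {linear subspace_type (sub_at P c) -> M c})
    (sub_at Q c).

Lemma sq_act c d (u : hom c d) (x : submodule_cmod P c) :
  x \in sq_sub c -> mact u x \in sq_sub d.
Proof. exact: sub_act. Qed.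

Definition subquotient : cmodule C :=
  quotient_cmod (@Submodule _ _ (submodule_cmod P) _ sq_act).

End Subquotient.

Section DirectSumModule.
Variables (k : fieldType) (C : lincat k) (M N : cmodule C).

Definition dm_obj (c : C) : lmodType k := (M c * N c)%type.

Definition dm_act (c d : C) (u : hom c d) (x : dm_obj c) : dm_obj d :=
  (mact u x.1, mact u x.2).

Lemma dm_act_bilinear c d : bilinear_for *:%R *:%R (@dm_act c d).
Proof. by split=> f a x y; rewrite /dm_act /= ?linearPl ?linearPr. Qed.

Lemma dm_act1 c (x : dm_obj c) : dm_act (idm c) x = x.
Proof. by rewrite /dm_act !mact1 -surjective_pairing. Qed.

Lemma dm_actM c d e (g : hom d e) (f : hom c d) (x : dm_obj c) :
  dm_act (compm g f) x = dm_act g (dm_act f x).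
Proof. by rewrite /dm_act !mactM. Qed.

Definition directsum_cmod : cmodule C :=
  Cmodule dm_act_bilinear dm_act1 dm_actM.

End DirectSumModule.

Definition direct_summand (k : fieldType) (C : lincat k) (N M : cmodule C) :
    Prop :=
  exists N' : cmodule C, cmod_iso (directsum_cmod N N') M.

Definition representable (k : fieldType) (C : lincat k) (c : C) : cmodule C :=
  @Cmodule k C (hom c) (fun d e (g : hom d e) (f : hom c d) => compm g f)
    (fun d e => comp_bilinear c d e) (fun d f => comp1m f)
    (fun d e l g f x => esym (compA g f x)).

Section Standard.
Variables (k : fieldType) (C : lincat k) (R : reedy C).

Definition reedy_ideal (alpha : rlam R) (c d : C) : subspace (hom c d) :=
  image_subspace (pm_comp (rplus R) (rminus R)
    (fun e : {e : C | wo_lt (rdeg R e) alpha} => sval e) c d).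

Lemma reedy_ideal_comp alpha c d e (g : hom d e) (f : hom c d) :
  f \in reedy_ideal alpha c d -> compm g f \in reedy_ideal alpha c e.
Proof.
pose J := reedy_ideal alpha c e.
move=> /asboolP[t ->]; rewrite -[_ \in _]/(_ \in preimage_subspace (compm g) J).
apply: pm_comp_ind => -[a /= a_lt] u v.
rewrite -[_ \in _]/(compm g (compm (val u) (val v)) \in J) compA.
have [t' _ t'K] := reedy_bij R a e.
rewrite -[compm g _]t'K.
rewrite -[_ \in _]/(_ \in preimage_subspace (applyr compm (val v)) J).
apply: pm_comp_ind => i u' v'.
rewrite -[_ \in _]/(compm (compm (val u') (val v')) (val v) \in J) -compA.
have [->|v'0] := eqVneq v' 0; first by rewrite linear0l linear0r rpred0.
have i_lt : wo_lt (rdeg R i) alpha.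
  have [<- //|ai] := pselect (a = i).
  apply: wo_lt_trans a_lt.
  exact: (proj2 (rminus_inverse R) _ _ v' ai (elimN eqP v'0)).
apply/asboolP; exists (dsingle (i := exist _ i i_lt) (tens u' (sc_comp v' v))).
by rewrite pm_comp_single.
Qed.

Definition ideal_submodule (alpha : rlam R) (c : C) :
    submodule (representable c) :=
  @Submodule _ _ (representable c) (reedy_ideal alpha c)
    (fun d e g f => @reedy_ideal_comp alpha c d e g f).

Definition standard (c : C) : cmodule C :=
  quotient_cmod (ideal_submodule (rdeg R c) c).

(* S is the well-ordered type of the ordinals <= sigma: these are exactly the
   well-ordered types with a greatest element, top standing for sigma and bot
   for 0. *)
Definition standard_filtered (M : cmodule C) : Prop :=
  exists (S : woType) (F : S -> submodule M),
    (exists bot top : S,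
      [/\ forall x, wo_le bot x, forall x, wo_le x top,
          forall c (x : M c), x \in sub_at (F bot) c -> x = 0
        & forall c (x : M c), x \in sub_at (F top) c]) /\
    [/\ forall s t, wo_le s t ->
          forall c (x : M c), x \in sub_at (F s) c -> x \in sub_at (F t) c,
        forall t, is_limit t -> forall c (x : M c),
          x \in sub_at (F t) c <-> exists2 s, wo_lt s t & x \in sub_at (F s) c
      & forall s t, is_succ s t ->
          exists c : C, cmod_iso (subquotient (F t) (F s)) (standard c)].

End Standard.

(* Main.v *)
(* The Reedy decomposition splits C(c, d) as C^+(c, d) plus the ideal of maps
   factoring through degree < deg c, so over C^+ the standard module of c becomes
   the free module C^+(c, -).  A module is then filtered by standard modules if
   and only if its restriction to C^+ is free: lifting the generators of the
   successive quotients of a filtration gives a C^+-basis, and conversely, for a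
   C^+-basis well-ordered compatibly with the degree, the span of an initial
   segment is stable under all of C.
   Over the direct category C^+ a retract N of a free module is free.  Going
   through all elements of N by increasing degree and keeping those not spanned by
   the previous ones gives phi : F -> N, with F free, which is onto; a section
   sigma exists since N is projective.  The kernel of phi at an object d involves
   only generators of degree < deg d, so sigma is onto by induction on the degree,
   and phi is injective. *)
From HB Require Import structures.
From mathcomp Require Import all_boot all_algebra.
From mathcomp Require Import wochoice.
From mathcomp Require Import boolp classical_sets functions cardinality fsbigop.
From mathcomp Require Import finmap.
Require Import Defs.

Set Implicit Arguments.
Unset Strict Implicit.
Unset Printing Implicit Defensive.

Import GRing.Theory.
Local Open Scope classical_set_scope.
Local Open Scope ring_scope.

(** * Minima, induction and finite maxima in well-ordered types *)

Section WellOrder.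
Variable T : woType.
Implicit Types x y z : T.

Lemma wo_le_refl x : wo_le x x.
Proof. by have := wo_le_total x x; rewrite orbb. Qed.

Lemma wo_ltW x y : wo_lt x y -> wo_le x y.
Proof. by move=> xy; have := wo_le_total x y; rewrite (negPf xy) orbF. Qed.

Lemma wo_lt_le_trans y x z : wo_lt x y -> wo_le y z -> wo_lt x z.
Proof.
move=> xy yz; have [zy|] := boolP (wo_le z y); last exact: wo_lt_trans.
by rewrite (wo_le_anti zy yz).
Qed.

Lemma wo_le_lt_trans y x z : wo_le x y -> wo_lt y z -> wo_lt x z.
Proof.
move=> xy yz; have [yx|yx] := boolP (wo_le y x); last exact: wo_lt_trans yz.
by rewrite (wo_le_anti xy yx).
Qed.

Lemma wo_le_trans y x z : wo_le x y -> wo_le y z -> wo_le x z.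
Proof.
move=> xy yz; have [//|] := boolP (wo_le x z).
by move=> /wo_lt_le_trans-/(_ _ xy) /negP.
Qed.

Lemma wo_lt_irr x : wo_lt x x = false.
Proof. by rewrite /wo_lt wo_le_refl. Qed.

Lemma wo_le_eqVlt x y : wo_le x y -> x = y \/ wo_lt x y.
Proof.
by move=> xy; have [yx|] := boolP (wo_le y x); [left; apply: wo_le_anti|right].
Qed.

Lemma wo_ltNge x y : wo_lt x y \/ wo_le y x.
Proof. by rewrite /wo_lt; case: wo_le; [right|left]. Qed.

Lemma wo_min (P : T -> Prop) :
  (exists x, P x) -> exists2 x, P x & forall y, P y -> wo_le x y.
Proof.
move=> [x Px]; have [|m [[/asboolP Pm mP] _]] :=
    wo_wellP (w := T) (A := [pred t | `[< P t >]]).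
  by exists x; apply/asboolP.
by exists m => // y Py; apply: mP; apply/asboolP.
Qed.

Lemma wo_ind (P : T -> Prop) :
  (forall x, (forall y, wo_lt y x -> P y) -> P x) -> forall x, P x.
Proof.
move=> IH x; apply: contrapT => nPx.
have [m nPm mmin] := wo_min (ex_intro (fun x => ~ P x) x nPx).
apply: nPm; apply: IH => y ym; apply: contrapT => /mmin.
by rewrite -[wo_le m y]negbK => /negP.
Qed.

Lemma wo_bot_succ_limit x :
  [\/ forall y, wo_le x y, exists y, is_succ y x | is_limit x].
Proof.
have [bx|/existsNP[y /negP yx]] := pselect (forall y, wo_le x y).
  by constructor 1.
have [|nsucc] := pselect (exists y, is_succ y x); first by constructor 2.
constructor 3; split; first by exists y.
move=> s sx; apply: contrapT => nex; apply: nsucc; exists s; split=> // u su.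
by have [ux|//] := wo_ltNge u x; case: nex; exists u.
Qed.

Lemma finite_wo_max (A : set T) : finite_set A -> A !=set0 ->
  exists2 m, A m & forall y, A y -> wo_le y m.
Proof.
move=> /(@finite_seqP {classic T})[s ->].
elim: s => [[]//|a s IH _].
have [[b bs]|s0] := pselect ([set` s] !=set0); last first.
  exists a => /=; first by rewrite inE eqxx.
  by move=> y; rewrite /= inE => /orP[/eqP->|ys]; [exact: wo_le_refl|case: s0; exists y].
have [m ms mmax] := IH (ex_intro _ b bs).
have [am|ma] := wo_ltNge a m.
  exists m => /=; first by rewrite inE [_ \in _]ms orbT.
  by move=> y; rewrite /= inE => /orP[/eqP->|/mmax//]; exact: wo_ltW.
exists a => /=; first by rewrite inE eqxx.
move=> y; rewrite /= inE => /orP[/eqP->|/mmax ym]; first exact: wo_le_refl.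
exact: wo_le_trans ma.
Qed.

End WellOrder.

(** A lexicographic order does it: values of [f] are compared first, and ties are broken by an
    arbitrary well-order of [T]. *)
Lemma well_order_refining (T : Type) (L : woType) (f : T -> L) :
  exists2 le : rel T, well_order le & forall x y, le x y -> wo_le (f x) (f y).
Proof.
have [r r_wo] := well_ordering_principle {classic T}.
pose W := WoType r_wo.
exists (fun x y => wo_lt (f x) (f y) || `[< f x = f y >] && r x y); last first.
  move=> x y /orP[/wo_ltW//|/andP[/asboolP -> _]]; exact: wo_le_refl.
move=> A [x0 Ax0].
have [_ [m1 Am1 <-] m1min] :=
  wo_min (ex_intro (fun l => exists2 x, x \in A & f x = l) _ (ex_intro2 _ _ x0 Ax0 erefl)).
have [m [Am fm] mmin] := @wo_min W (fun x => x \in A /\ f x = f m1)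
  (ex_intro _ m1 (conj Am1 erefl)).
exists m; split.
  split=> // x Ax; have := m1min _ (ex_intro2 _ _ x Ax erefl).
  rewrite -fm => /wo_le_eqVlt[fmx|->//]; apply/orP; right.
  apply/andP; split; first exact/asboolP.
  by apply: mmin; rewrite -fmx.
move=> y [Ay ymin]; have fy : f y = f m1.
  apply: wo_le_anti; last by apply: m1min; exists y.
  have /orP[/wo_ltW|/andP[/asboolP -> _]] := ymin _ Am1 => //.
  exact: wo_le_refl.
have /orP[|/andP[_ ym]] := ymin _ Am; first by rewrite fy fm wo_lt_irr.
apply: (@wo_le_anti W); last exact: ym.
by apply: mmin.
Qed.

(** * Linear maps and direct sums of vector spaces *)

Lemma bijective_linear (k : fieldType) (V W : lmodType k) (f : {linear V -> W}) :
  (forall x, f x = 0 -> x = 0) -> (forall y, exists x, y = f x) -> bijective f.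
Proof.
move=> f0 /choice[g gK]; exists g => // x.
by apply/eqP; rewrite -subr_eq0; apply/eqP/f0; rewrite linearB -gK subrr.
Qed.

Lemma linear_inverse (k : fieldType) (V W : lmodType k) (f : {linear V -> W}) :
  bijective f -> exists g : {linear W -> V}, cancel f g /\ cancel g f.
Proof.
case=> g fK gK.
pose gl : {linear W -> V} :=
  HB.pack g (GRing.isLinear.Build _ _ _ _ g (can2_linear fK gK)).
by exists gl.
Qed.

Lemma qpi_eq0 (k : fieldType) (V : lmodType k) (S : subspace V) (x : V) :
  qpi S x = 0 <-> x \in S.
Proof.
rewrite -[X in X \in _](subr0 x); split=> [x0|/qpiP ->]; last exact: linear0.
by apply/qpiP; rewrite x0 linear0.
Qed.

Section DirectSum.
Variables (k : fieldType) (I : Type) (V : I -> lmodType k).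

Lemma dsingle_neq i j (v : V i) : i <> j -> dsingle v j = 0.
Proof. by move=> ij; rewrite /= /dsingle_fun; case: pselect. Qed.

Lemma dlift_in (W : lmodType k) (S : subspace W) (f : forall i, {linear V i -> W})
    (x : dsum V) :
  (forall i, f i (x i) \in S) -> dlift f x \in S.
Proof. by move=> fS; apply: rpred_sum => i _; apply: fS. Qed.

(** The supports of [x] and [y] may differ; over their union [A] the two finite sums agree term by
    term. *)
Lemma linear_dlift (V' : I -> lmodType k) (U W : lmodType k) (h : {linear U -> W})
    (f : forall i, {linear V i -> U}) (g : forall i, {linear V' i -> W})
    (x : dsum V) (y : dsum V') :
  (forall i, h (f i (x i)) = g i (y i)) -> h (dlift f x) = dlift g y.
Proof.
move=> hfg.
pose A : {fset {classic I}} := fset_set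
  ([set i : {classic I} | x i != 0] `|` [set i : {classic I} | y i != 0]).
have inA i : (i \in A) = (x i != 0) || (y i != 0).
  rewrite in_fset_set; last by rewrite finite_setU; split; exact: dcoef_fin.
  by apply/idP/orP => [/set_mem|?] //; exact: mem_set.
have xA i : x i != 0 -> (i : {classic I}) \in A by rewrite inA => ->.
have yA i : y i != 0 -> (i : {classic I}) \in A by rewrite inA orbC => ->.
rewrite [dlift f x](dlift_funE f xA) [dlift g y](dlift_funE g yA) raddf_sum.
by apply: eq_bigr => i _; apply: hfg.
Qed.

Lemma dsumBE (x y : dsum V) i : (x - y) i = x i - y i.
Proof. by []. Qed.

Lemma dsum_in (S : subspace (dsum V)) (x : dsum V) :
  (forall i, x i != 0 -> dsingle (x i) \in S) -> x \in S.
Proof.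
move=> xS; pose A : {fset {classic I}} := fset_set [set i : {classic I} | x i != 0].
have inA i : (i \in A) = (x i != 0).
  rewrite in_fset_set; last exact: dcoef_fin.
  by apply/idP/idP => [/set_mem|?] //; exact: mem_set.
have -> : x = \sum_(i <- A) dsingle (x (i : I)).
  apply/dsumP => j; rewrite (big_morph (fun y : dsum V => y j) (id1 := 0) (op1 := +%R)) //.
  have [xj|xj] := boolP (x j == 0).
    rewrite (eqP xj) big1_seq // => i /andP[_]; rewrite inA => xi.
    by apply: dsingle_neq => ij; rewrite -ij (negPf xi) in xj.
  have jA : (j : {classic I}) \in A by rewrite inA.
  rewrite (big_fsetD1 _ jA) dsingleE big1_seq; last first.
    by move=> i /andP[_]; rewrite !inE => /andP[/eqP ij _]; apply: dsingle_neq.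
  by rewrite [RHS]addr0.
by rewrite big_seq; apply: rpred_sum => i; rewrite inA; exact: xS.
Qed.

End DirectSum.

(** Provides leading terms: the support of a nonzero element is finite and nonempty, so the ranks
    [r] attain a maximum on it. *)
Lemma dsum_max (k : fieldType) (I : Type) (V : I -> lmodType k) (T : woType)
    (r : I -> T) (x : dsum V) :
  x <> 0 -> exists2 i, x i != 0 & forall j, x j != 0 -> wo_le (r j) (r i).
Proof.
move=> x0; have [_ [i xi <-] imax] : exists2 m, (r @` [set i | x i != 0]) m &
    forall y, (r @` [set i | x i != 0]) y -> wo_le y m.
  apply: finite_wo_max; first exact/finite_image/dcoef_fin.
  apply: contrapT => nex; apply: x0; apply/dsumP => i; apply/eqP.
  by apply: contrapT => /negP xi; apply: nex; exists (r i), i.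
by exists i => // j xj; apply: imax; exists j.
Qed.

(** * Homomorphisms and free modules over a linear category *)

Definition cmod_hom (k : fieldType) (D : lincat k) (M N : cmodule D)
    (f : forall d, {linear M d -> N d}) : Prop :=
  forall c d (u : hom c d) (x : M c), f d (mact u x) = mact u (f c x).

HB.instance Definition _ (k : fieldType) (D : lincat k) (M : cmodule D) (c d : D)
    (u : hom c d) :=
  GRing.isLinear.Build k (M c) (M d) *:%R (@mact k D M c d u)
    ((mact_bilinear M c d).2 u).

Lemma cmod_hom_inv (k : fieldType) (D : lincat k) (M N : cmodule D)
    (f : forall d, {linear M d -> N d}) :
  cmod_hom f -> (forall d, bijective (f d)) ->
  exists2 g : forall d, {linear N d -> M d},
    cmod_hom g & forall d, cancel (f d) (g d) /\ cancel (g d) (f d).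
Proof.
move=> fP fbij.
have inv d : {g : {linear N d -> M d} | cancel (f d) g /\ cancel g (f d)}.
  exact/cid/linear_inverse.
exists (fun d => sval (inv d)); last by move=> d; exact: (svalP (inv d)).
move=> c d u x; have [fKd gKd] := svalP (inv d); have [fKc gKc] := svalP (inv c).
by rewrite -{1}[x]gKc -fP fKd.
Qed.

Lemma mact0l (k : fieldType) (D : lincat k) (M : cmodule D) c d (x : M c) :
  mact (0 : hom c d) x = 0.
Proof. exact: linear0l. Qed.

Lemma mactZl (k : fieldType) (D : lincat k) (M : cmodule D) c d a (u : hom c d)
    (x : M c) :
  mact (a *: u) x = a *: mact u x.
Proof. exact: linearZl_LR. Qed.

Section FreeModule.
Variables (k : fieldType) (D : lincat k) (I : Type) (c : I -> D).

Definition free_obj (d : D) : lmodType k := dsum (fun i => hom (c i) d).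

Lemma free_act_fin d e (g : hom d e) (t : free_obj d) :
  finite_set [set i | compm g (t i) != 0].
Proof.
apply: sub_finite_set (dcoef_fin t) => i /=; apply: contra_neq => ->.
exact: linear0.
Qed.

Definition free_act d e (g : hom d e) (t : free_obj d) : free_obj e :=
  Dsum (free_act_fin g t).

Lemma free_act_bilinear d e : bilinear_for *:%R *:%R (@free_act d e).
Proof.
by split=> f a x y; apply/dsumP => i; rewrite dsumDE dsumZE /= ?linearPl ?linearPr.
Qed.

Lemma free_act1 d (t : free_obj d) : free_act (idm d) t = t.
Proof. by apply/dsumP => i /=; rewrite comp1m. Qed.

Lemma free_actM d e l (g : hom e l) (f : hom d e) (t : free_obj d) :
  free_act (compm g f) t = free_act g (free_act f t).
Proof. by apply/dsumP => i /=; rewrite compA. Qed.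

Definition free_cmod : cmodule D :=
  Cmodule free_act_bilinear free_act1 free_actM.

Lemma free_actE d e (g : hom d e) (t : free_cmod d) i :
  (mact g t : free_obj e) i = compm g ((t : free_obj d) i).
Proof. by []. Qed.

Definition free_gen (i : I) d (u : hom (c i) d) : free_cmod d :=
  dsingle (V := fun i => hom (c i) d) (i := i) u.

Section Generated.
Variables (N : cmodule D) (b : forall i, N (c i)).

Definition gen_at (d : D) (i : I) : {linear hom (c i) d -> N d} :=
  applyr (@mact k D N (c i) d) (b i).

(** Yoneda's lemma on each representable summand: this is the homomorphism that sends the identity
    of [c i] to [b i]. *)
Definition gen (d : D) : {linear free_cmod d -> N d} := dlift (gen_at d).

Lemma gen_free_gen i d (u : hom (c i) d) : gen d (free_gen u) = mact u (b i).
Proof. exact: dlift_single. Qed.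

Lemma gen_in d (S : subspace (N d)) (t : free_obj d) :
  (forall i, mact (t i) (b i) \in S) -> gen d t \in S.
Proof. by move=> tS; apply: (@dlift_in _ _ _ _ S (gen_at d) t). Qed.

(** The term at [i] is [gen d t] minus the combination of all other terms. This isolates leading
    terms. *)
Lemma gen_term_in d (S : subspace (N d)) (t : free_obj d) i :
  gen d t \in S -> (forall j, i <> j -> mact (t j) (b j) \in S) ->
  mact (t i) (b i) \in S.
Proof.
move=> tS otherS; rewrite -gen_free_gen -[free_gen _](subKr t) linearB rpredB //.
apply: gen_in => j; rewrite dsumBE; have [<-|ij] := pselect (i = j).
  by rewrite dsingleE subrr mact0l rpred0.
by rewrite dsingle_neq // subr0 otherS.
Qed.

Lemma gen_hom : cmod_hom gen.
Proof.
move=> d e u t; rewrite -[RHS]/((mact u : {linear N d -> N e}) (gen d t)).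
by apply/esym/linear_dlift => i /=; rewrite mactM.
Qed.

Definition is_basis := forall d, bijective (gen d).

End Generated.

Lemma hom_gen (M N : cmodule D) (f : forall d, {linear M d -> N d})
    (b : forall i, M (c i)) :
  cmod_hom f ->
  forall d t, f d (gen b d t) = gen (fun i => f (c i) (b i)) d t.
Proof. by move=> fP d t; apply: linear_dlift => i /=; rewrite fP. Qed.

End FreeModule.

(** * Retracts of free modules over a direct category *)

Section Direct.
Variables (k : fieldType) (D : lincat k) (lam : woType) (deg : D -> lam).
Hypothesis Ddir : direct_wrt deg.

Lemma endo_scalar (c : D) : endo_iso_scalars c ->
  forall f : hom c c, exists a, f = a *: idm c.
Proof.
move=> [h [[h' _ hK] h1 _]] f; exists (h' f).
by rewrite -h1 -linearZ -[_ *: 1]/(h' f * 1) mulr1 hK.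
Qed.

Lemma direct_deg (c d : D) (f : hom c d) :
  f != 0 -> c = d \/ wo_lt (deg c) (deg d).
Proof.
move=> f0; have [->|cd] := pselect (c = d); [by left|right].
by apply: (Ddir.2 _ _ f cd); apply/eqP.
Qed.

Section GreedyBasis.
Variable N : cmodule D.

Definition elem := {d : D & N d}.

Variable le : rel elem.
Hypothesis le_wo : well_order le.
Hypothesis le_deg : forall p q, le p q -> wo_le (deg (projT1 p)) (deg (projT1 q)).

Let W : woType := WoType le_wo.

(** The value at [d] of the submodule generated by all elements that precede [p], at whatever object
    they live. *)
Definition lower_span (p : elem) (d : D) : subspace (N d) :=
  lspan [set y | exists2 q : elem, @wo_lt W q p &
                   exists g : hom (projT1 q) d, y = mact g (projT2 q)].

(* The elements not spanned by the smaller ones; le_deg makes "smaller" include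
   every element at an object of smaller degree. *)
Definition greedy := {p : elem | projT2 p \notin lower_span p (projT1 p)}.
Definition greedy_obj (x : greedy) : D := projT1 (sval x).
Definition greedy_elem (x : greedy) : N (greedy_obj x) := projT2 (sval x).

Local Notation phi := (gen greedy_elem).

(** Induction along [le]: a kept element is the image of its own generator, and a discarded one is a
    combination of images of smaller elements. *)
Lemma greedy_span d (y : N d) : exists t, y = phi d t.
Proof.
suff H (p : W) : exists t, projT2 p = phi (projT1 p) t by exact: (H (existT _ d y)).
elim/wo_ind: p => p IH.
have [pl|pnl] := boolP (projT2 p \in lower_span p (projT1 p)); last first.
  pose x : greedy := exist _ p pnl.
  by exists (free_gen (i := x) (idm (greedy_obj x))); rewrite gen_free_gen mact1.
apply/asboolP.
move: pl => /asboolP /(_ (image_subspace (phi (projT1 p)))); apply.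
move=> _ [q qp [g ->]]; apply/asboolP; have [t ->] := IH q qp.
by exists (mact g t); rewrite gen_hom.
Qed.

(** If a generator living at [d] occurred in [t], the [le]-largest generator [m] of [t] would live
    at [d] too. Its coefficient would be a nonzero scalar, and the relation would put [m] in its own
    lower span, against the choice of kept elements. *)
Lemma greedy_indep d (t : free_obj greedy_obj d) :
  phi d t = 0 -> forall x, t x != 0 -> wo_lt (deg (greedy_obj x)) (deg d).
Proof.
move=> t0 x tx; have [xd|//] := direct_deg tx.
have tn0 : t <> 0 by move=> tE; rewrite tE eqxx in tx.
have [m tm mmax] := @dsum_max _ _ _ W sval t tn0.
have degxm := le_deg (mmax x tx).
(* Were [m] not at [d], its degree would be smaller than that of [x], although [x] precedes or
   equals [m]. *)
have [md|] := direct_deg tm; last first.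
  by rewrite -xd => /(wo_le_lt_trans degxm); rewrite wo_lt_irr.
move: t t0 tn0 tm mmax {tx xd degxm}; rewrite -{d}md => t t0 _ tm mmax.
have [a ta] := endo_scalar (Ddir.1 _) (t m).
have a0 : a != 0 by apply: contra_neq tm => a0; rewrite ta a0 scale0r.
have /negP[] := svalP m.
rewrite -[projT2 _]/(greedy_elem m).
pose S := lower_span (sval m) (greedy_obj m).
have : mact (t m) (greedy_elem m) \in S.
  apply: gen_term_in => [|j mj]; first by rewrite t0 rpred0.
  have [->|tj] := eqVneq (t j) 0; first by rewrite mact0l rpred0.
  apply/asboolP => S' S'P; apply: S'P; exists (sval j); last by exists (t j).
  have /wo_le_eqVlt[jm|//] := mmax j tj.
  by case: mj; apply: val_inj.
rewrite ta mactZl mact1 => bm.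
by rewrite -[greedy_elem m]scale1r -(mulVf a0) -scalerA rpredZ.
Qed.

End GreedyBasis.

(* The basis elements of P are lifted along the cover gen B of N; composing the
   lift with iota gives the section sigma. *)
Theorem retract_basis (P N : cmodule D) (iota : forall d, {linear N d -> P d})
    (pi : forall d, {linear P d -> N d}) (I : Type) (c : I -> D)
    (b : forall i, P (c i)) :
  cmod_hom iota -> cmod_hom pi -> (forall d, cancel (iota d) (pi d)) ->
  is_basis b ->
  exists (J : Type) (c' : J -> D) (b' : forall j, N (c' j)), is_basis b'.
Proof.
move=> iotaP piP iotaK bP.
have [le le_wo le_deg] :=
  well_order_refining (fun p : elem N => deg (projT1 p)).
exists (greedy le_wo), (@greedy_obj _ _ le_wo), (@greedy_elem _ _ le_wo).
set B := @greedy_elem _ _ le_wo; set phi := gen B.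
have [y yP] : exists y : forall i, free_cmod (@greedy_obj _ _ le_wo) (c i),
    forall i, pi (c i) (b i) = phi (c i) (y i).
  have H i : {t | pi (c i) (b i) = phi (c i) t} by apply: cid; apply: greedy_span.
  by exists (fun i => sval (H i)) => i; apply: svalP (H i).
have [binv binvP binvK] := cmod_hom_inv (gen_hom b) bP.
pose sigma d : {linear N d -> free_cmod (@greedy_obj _ _ le_wo) d} :=
  gen y d \o (binv d \o iota d).
have sigmaE d x : sigma d x = gen y d (binv d (iota d x)) by [].
have sigmaP : cmod_hom sigma.
  by move=> d e u x; rewrite !sigmaE iotaP binvP gen_hom.
have sigmaK d : cancel (sigma d) (phi d).
  move=> x; rewrite sigmaE (hom_gen _ (gen_hom B)).
  have -> : (fun i => gen B (c i) (y i)) = (fun i => pi (c i) (b i)).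
    by apply: functional_extensionality_dep => i; rewrite yP.
  by rewrite -(hom_gen _ piP) (binvK d).2 iotaK.
(* Induction on the degree of [d], for all objects of that degree at once. *)
have sigma_surj d t : t \in image_subspace (sigma d).
  have [l] : exists l, l = deg d by exists (deg d).
  elim/wo_ind: l d t => l IH d t dl.
  (* A generator of smaller degree is a value of [sigma] at its own object, by induction; naturality
     carries this over to [d]. *)
  have lower (s : free_cmod (@greedy_obj _ _ le_wo) d) :
      (forall x, (s : free_obj _ d) x != 0 -> wo_lt (deg (greedy_obj x)) (deg d)) ->
      s \in image_subspace (sigma d).
    move=> slt; apply: dsum_in => x /slt xd; rewrite dl in IH.
    have /asboolP[n nE] :=
      IH _ xd _ (free_gen (i := x) (idm (greedy_obj x))) erefl.
    apply/asboolP; exists (mact (dcoef s x) n); rewrite sigmaP -nE.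
    apply/dsumP => j; rewrite free_actE.
    have [<-|xj] := pselect (x = j); first by rewrite !dsingleE compm1.
    by rewrite !dsingle_neq // linear0.
  apply: dsum_in => x tx.
  have [xd|xd] := direct_deg tx; last first.
    apply: lower => j; have [<- //|xj] := pselect (x = j).
    by rewrite dsingle_neq ?eqxx.
  move: t tx lower {IH dl}; rewrite -{d}xd => t tx lower.
  have [a ta] := endo_scalar (Ddir.1 _) (t x).
  set e : free_cmod _ _ := free_gen (i := x) (idm (greedy_obj x)).
  (* The first summand is a value of [sigma]; the second is killed by [phi], hence involves only
     generators of smaller degree. *)
  have -> : dsingle (V := fun i => hom (greedy_obj i) (greedy_obj x)) (t x) =
      a *: (sigma _ (phi _ e) + (e - sigma _ (phi _ e))).
    rewrite addrC subrK; apply/dsumP => j; rewrite dsumZE.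
    have [<-|xj] := pselect (x = j); first by rewrite !dsingleE.
    by rewrite !dsingle_neq // scaler0.
  apply/rpredZ/rpredD; first by apply/asboolP; exists (phi _ e).
  apply: lower; apply: (greedy_indep le_deg).
  by rewrite linearB -[gen _ _]/(phi _) sigmaK subrr.
move=> d; apply: bijective_linear => [t t0|z]; last exact: greedy_span.
have /asboolP[n tE] := sigma_surj d t.
by rewrite tE -[n]sigmaK -tE t0 linear0.
Qed.

End Direct.

(** * The Reedy decomposition and standard subquotients *)

Section Reedy.
Variables (k : fieldType) (C : lincat k) (R : reedy C).

Local Notation Cp := (rplus R).
Local Notation Cm := (rminus R).

Lemma comp_pm_in_ideal alpha (c d e : C) (g : sc_hom Cp e d) (f : sc_hom Cm c e) :
  wo_lt (rdeg R e) alpha -> comp_pm g f \in reedy_ideal alpha c d.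
Proof.
move=> lt_e; apply/asboolP.
exists (dsingle (V := fun i : {e | wo_lt (rdeg R e) alpha} =>
  tensor (sc_hom Cp (sval i) d) (sc_hom Cm c (sval i))) (i := exist _ e lt_e)
  (tens g f)).
by rewrite pm_comp_single.
Qed.

(** By linearity a product of [g] and [f] through [e] suffices. If [e] differs from [c], a nonzero
    [f] lowers the degree and the product is in the ideal; otherwise [f] is a scalar and the product
    is in [Cp]. With [plus_ideal0] this makes the sum direct. *)
Lemma plus_plus_ideal (c d : C) (u : hom c d) :
  exists g : sc_hom Cp c d, u - val g \in reedy_ideal (rdeg R c) c d.
Proof.
pose J := reedy_ideal (rdeg R c) c d.
pose S0 : {pred hom c d} := [pred u | `[< exists g : sc_hom Cp c d, u - val g \in J >]].
have S0_closed : submod_closed S0.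
  split=> [|a v w /asboolP[g vg] /asboolP[h wh]]; apply/asboolP.
    by exists 0; rewrite subrr rpred0.
  exists (a *: g + h); rewrite [val _]/(a *: val g + val h) opprD addrACA -scalerBr.
  by rewrite rpredD ?rpredZ.
have [t _ tK] := reedy_bij R c d; rewrite -[u]tK.
apply/asboolP; apply: (pm_comp_ind (S := Subspace S0_closed)) => e g f.
apply/asboolP; have [->|f0] := eqVneq f 0.
  by exists 0; rewrite linear0r subr0 rpred0.
have [ec|ec] := pselect (c = e); last first.
  exists 0; rewrite subr0; apply: comp_pm_in_ideal.
  exact: ((rminus_inverse R).2 _ _ f ec (elimN eqP f0)).
case: e / ec g f {f0} => g f.
have [a ->] := endo_scalar (D := Cm) ((rminus_inverse R).1 c) f.
exists (a *: g); rewrite (_ : comp_pm g _ = val (a *: g)) ?subrr ?rpred0 //.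
rewrite [LHS](linearZr_LR compm); congr (_ *: _); exact: compm1.
Qed.

(* A preimage of g in the sum over the objects of degree < deg c has no component
   at c, whereas the preimage g (x) id is concentrated there. *)
Lemma plus_ideal0 (c d : C) (g : sc_hom Cp c d) :
  val g \in reedy_ideal (rdeg R c) c d -> g = 0.
Proof.
move=> /asboolP[t gt].
pose all_comp := pm_comp Cp Cm (fun e : C => e) c d.
(* Composites with a preimage in the full sum that vanishes at [c]. They contain the ideal, as its
   intermediate objects have degree below that of [c]. *)
pose S0 : {pred hom c d} :=
  [pred u | `[< exists2 s : pm_sum Cp Cm (fun e : C => e) c d,
                  dcoef s c = 0 & u = all_comp s >]].
have S0_closed : submod_closed S0.
  split=> [|a _ _ /asboolP[s s0 ->] /asboolP[r r0 ->]]; apply/asboolP.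
    by exists 0; rewrite ?linear0.
  by exists (a *: s + r); rewrite ?linearP //= s0 r0 scaler0 addr0.
have /asboolP[s s0 gs] : val g \in Subspace S0_closed.
  rewrite gt; apply: pm_comp_ind => -[e /= lt_e] h f; apply/asboolP.
  exists (dsingle (V := fun i : C => tensor (sc_hom Cp i d) (sc_hom Cm c i))
    (i := e) (tens h f)); last by rewrite /all_comp (@pm_comp_single _ _ Cp Cm C (fun e => e)).
  rewrite (@dsingle_neq _ _ _ e c) // => ec.
  by rewrite ec wo_lt_irr in lt_e.
pose r : pm_sum Cp Cm (fun e : C => e) c d :=
  dsingle (V := fun i : C => tensor (sc_hom Cp i d) (sc_hom Cm c i))
    (i := c) (tens g (sc_id Cm c)).
have rs : r = s.
  apply: (bij_inj (reedy_bij R c d)); rewrite -[RHS]gs.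
  by rewrite (@pm_comp_single _ _ Cp Cm C (fun e => e)) [LHS]compm1.
have g0 : tens g (sc_id Cm c) = 0 by rewrite -s0 -rs dsingleE.
have [h [hbij h1 _]] := (rminus_inverse R).1 c.
have [l [hl _]] := linear_inverse hbij.
(* Contracting the second factor along End(c) = k recovers g from g (x) id. *)
pose scal (g : sc_hom Cp c d) (f : sc_hom Cm c c) : sc_hom Cp c d := (l f : k) *: g.
have scalP : bilinear_for *:%R *:%R scal.
  split=> [f|f'] a x y; rewrite /scal.
    by rewrite scalerDr scalerA mulrC; congr (_ + _); exact/esym/scalerA.
  rewrite [l _](linearP l) scalerDl; congr (_ + _); exact/esym/scalerA.
pose scalb : {bilinear sc_hom Cp c d -> sc_hom Cm c c -> sc_hom Cp c d} :=
  HB.pack scal (bilinear_isBilinear.Build _ _ _ _ _ _ scal scalP).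
have := tliftE scalb g (sc_id Cm c); rewrite g0 linear0.
by rewrite /= /scal -[sc_id _ _]h1 hl scale1r.
Qed.

(** A Yoneda argument: [x] represents the image of the class of [idm c]. The two conditions say that
    the map induced by acting on [x], from the standard module to the subquotient, is well defined
    and injective, and surjective. *)
Lemma subquotient_standardP (M : cmodule C) (P Q : submodule M) (c : C) :
  cmod_iso (subquotient P Q) (standard R c) <->
  exists2 x : M c, x \in sub_at P c &
    (forall d (u : hom c d),
       mact u x \in sub_at Q d <-> u \in reedy_ideal (rdeg R c) c d) /\
    (forall d (y : M d), y \in sub_at P d ->
       exists u : hom c d, y - mact u x \in sub_at Q d).
Proof.
split.
  case=> f [fP fbij].
  have [g _ gK] := cmod_hom_inv fP fbij.
  pose q d (z : submodule_cmod P d) : subquotient P Q d := qpi _ z.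
  have qE d z : q d z = 0 <-> val z \in sub_at Q d by exact: qpi_eq0.
  pose x := qrepr (g c (qpi (reedy_ideal (rdeg R c) c c) (idm c))).
  have fx d u : f d (q d (mact u x)) = qpi (reedy_ideal (rdeg R c) c d) u.
    have -> : q d (mact u x) = mact u (q c x) by rewrite [RHS]qm_actE.
    by rewrite fP /q qreprK (gK c).2 [LHS]qm_actE [mact _ _]compm1.
  have f0 d z : f d z = 0 <-> z = 0.
    split=> [z0|->]; last exact: linear0.
    by apply: (bij_inj (fbij d)); rewrite z0 linear0.
  exists (val x); first exact: valP.
  split=> [d u|d y yP].
    by rewrite -(qE d (mact u x)) -f0 fx qpi_eq0.
  pose z : submodule_cmod P d := exist _ y yP.
  exists (qrepr (f d (q d z))); apply/(qE d (z - mact _ x))/f0.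
  by rewrite /q linearB linearB fx qreprK subrr.
case=> x xP [xQ xsurj].
pose x' : submodule_cmod P c := exist _ x xP.
pose h0 d (u : hom c d) : subquotient P Q d := qpi _ (mact u x').
have h0P d : linear (h0 d).
  by move=> a u v; rewrite /h0 linearPl linearP.
pose h d : {linear representable c d -> subquotient P Q d} :=
  HB.pack (h0 d) (GRing.isLinear.Build _ _ _ _ (h0 d) (h0P d)).
have hE d u : h d u = 0 <-> u \in reedy_ideal (rdeg R c) c d.
  by rewrite -xQ; exact: qpi_eq0.
have hI d u : u \in reedy_ideal (rdeg R c) c d -> h d u = 0 by move/hE.
pose f d : {linear standard R c d -> subquotient P Q d} := qlift (@hI d).
have fE d u : f d (qpi _ u) = h d u by exact: qlift_funE.
have fP : cmod_hom f.
  move=> d e u y; rewrite -[y]qreprK [mact u _]qm_actE !fE.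
  by rewrite [RHS]qm_actE /= /h0 mactM.
have fbij d : bijective (f d).
  apply: bijective_linear => [y|y].
    by rewrite -[y]qreprK fE hE qpi_eq0.
  have [u uQ] := xsurj d (val (qrepr y)) (valP (qrepr y)).
  exists (qpi _ u); rewrite fE -[LHS]qreprK; apply/qpiP.
  exact: uQ.
have [g gP gK] := cmod_hom_inv fP fbij.
by exists g; split=> // d; exists (f d); case: (gK d).
Qed.

(** * From a standard filtration to a basis over [Cp] *)

Section Restriction.
Variables (S : wide_subcat C) (M : cmodule C).

Definition res_act (c d : C) (g : sc_hom S c d) (x : M c) : M d := mact (val g) x.

Lemma res_act_bilinear c d : bilinear_for *:%R *:%R (@res_act c d).
Proof. by split=> f a x y; rewrite /res_act /= ?linearPl ?linearPr. Qed.

Definition res_cmod : cmodule S :=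
  @Cmodule k S M res_act res_act_bilinear (@mact1 _ _ M)
    (fun d e l g f x => mactM (val g) (val f) x).

End Restriction.

(** Each successor step contributes one basis element. Spanning is proved by induction along the
    filtration; independence holds because the leading coefficient of a relation lies both in [Cp]
    and in the ideal. *)
Lemma standard_filtered_basis (M : cmodule C) : standard_filtered R M ->
  exists (I : Type) (c : I -> C) (b : forall i, M (c i)),
    is_basis (D := Cp) (c := c) (N := res_cmod Cp M) b.
Proof.
case=> S [F [[bot [top [botP topP F0 F1]]] [Fmono Flim Fsucc]]].
pose I := {s : S | exists t, is_succ s t}.
have step (i : I) : {cx : {c : C & M c} | exists2 t, is_succ (sval i) t &
    [/\ projT2 cx \in sub_at (F t) (projT1 cx),
        forall d (u : hom (projT1 cx) d), mact u (projT2 cx) \in sub_at (F (sval i)) d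
          <-> u \in reedy_ideal (rdeg R (projT1 cx)) (projT1 cx) d
      & forall d y, y \in sub_at (F t) d -> exists u : hom (projT1 cx) d,
          y - mact u (projT2 cx) \in sub_at (F (sval i)) d]}.
  apply: cid; case: i => s [t st] /=; have [c] := Fsucc _ _ st.
  case/subquotient_standardP => x xF [xI xsurj].
  by exists (existT _ c x), t.
pose c i := projT1 (sval (step i)); pose b i : M (c i) := projT2 (sval (step i)).
exists I, c, b.
set phi := gen (D := Cp) (N := res_cmod Cp M) b.
have span s d y : y \in sub_at (F s) d -> exists t, y = phi d t.
  elim/wo_ind: s d y => s IH d y ys.
  have [sbot|[r rs]|slim] := wo_bot_succ_limit s; last first.
  - by have [r rs yr] := (Flim s slim d y).1 ys; apply: IH rs _ _ yr.
  - pose i : I := exist _ r (ex_intro _ s rs).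
    have [s' rs' [_ bI bsurj]] := svalP (step i).
    have ss' : s = s' by apply: wo_le_anti; [apply: rs.2 rs'.1|apply: rs'.2 rs.1].
    rewrite -ss' in bsurj; have [u yu] := bsurj d y ys.
    (* The coefficient [u] may be replaced by its part [g] in [Cp]: the ideal part sends [b i] into
       the previous stage. *)
    have [g ug] := plus_plus_ideal u.
    have yg : y - mact (val g) (b i) \in sub_at (F r) d.
      have := rpredD yu ((bI d _).2 ug).
      by rewrite linearBl addrA subrK.
    have [t yt] := IH r rs.1 d _ yg.
    exists (t + free_gen (D := Cp) (c := c) (i := i) g).
    rewrite linearD -yt (_ : phi d (free_gen _) = mact (val g) (b i)).
      by rewrite subrK.
    exact: (@gen_free_gen _ Cp).
  - exists 0; rewrite linear0; apply: F0; exact: Fmono (sbot bot) _ _ ys.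
move=> d; apply: bijective_linear => [t t0|y]; last exact: (span top).
apply: contrapT => /(dsum_max (sval : I -> S))[i ti imax].
have [s is_ [_ bI _]] := svalP (step i).
(* The other terms have index [j] below [i], so [b j] already lies in the stage after [j], which is
   contained in stage [i]. *)
have : mact (val (dcoef t i)) (b i) \in sub_at (F (sval i)) d.
  apply: (@gen_term_in _ _ _ _ (res_cmod Cp M) b) => [|j ij].
    by rewrite [gen _ _ _]t0 rpred0.
  have [->|tj] := eqVneq (dcoef t j) 0; first by rewrite mact0l rpred0.
  have [r jr [bF _ _]] := svalP (step j).
  have /wo_le_eqVlt[ji|ji] := imax j tj; first case: ij.
    by apply: eq_sig_hprop (esym ji) => z; apply: Prop_irrelevance.
  apply: (@sub_act _ _ _ _ _ _ (val (dcoef t j)) (b j)); exact: Fmono (jr.2 _ ji) _ _ bF.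
by move/bI/plus_ideal0 => ti0; rewrite ti0 eqxx in ti.
Qed.

End Reedy.

(** * From a basis over [Cp] to a standard filtration *)

Section BasisFiltration.
Variables (k : fieldType) (C : lincat k) (R : reedy C).

Local Notation Cp := (rplus R).

Variables (N : cmodule C) (W : woType) (c : W -> C) (b : forall i, N (c i)).
Hypothesis b_basis : is_basis (D := Cp) (c := c) (N := res_cmod Cp N) b.
Hypothesis c_deg : forall i j,
  wo_lt (rdeg R (c i)) (rdeg R (c j)) -> wo_lt i j.

Let phi d : {linear free_cmod (D := Cp) c d -> N d} :=
  gen (D := Cp) (N := res_cmod Cp N) b d.

Let phi_gen i d (g : sc_hom Cp (c i) d) :
  phi d (free_gen (D := Cp) (c := c) (i := i) g) = mact (val g) (b i).
Proof. exact: (@gen_free_gen k Cp W c (res_cmod Cp N) b). Qed.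

Definition span_pred (A : W -> Prop) d : {pred N d} :=
  [pred y | `[< exists2 t : free_cmod (D := Cp) c d,
                  forall i, dcoef t i != 0 -> A i & y = phi d t >]].

Lemma span_closed A d : submod_closed (@span_pred A d).
Proof.
split=> [|a _ _ /asboolP[t tA ->] /asboolP[u uA ->]]; apply/asboolP.
  by exists 0; [move=> i; rewrite eqxx|rewrite linear0].
exists (a *: t + u); last by rewrite linearP.
move=> i /=; have [ti|/tA//] := eqVneq (dcoef t i) 0.
by rewrite ti scaler0 add0r; exact: uA.
Qed.

Definition span_sub A d := Subspace (@span_closed A d).

Lemma span_gen (A : W -> Prop) i d (g : sc_hom Cp (c i) d) :
  A i -> mact (val g) (b i) \in span_sub A d.
Proof.
move=> Ai; apply/asboolP; exists (free_gen (D := Cp) (c := c) (i := i) g).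
  move=> j; have [<-//|ij] := pselect (i = j).
  by rewrite dsingle_neq // eqxx.
exact/esym/phi_gen.
Qed.

Lemma span_min (A : W -> Prop) d (S : subspace (N d)) :
  (forall i (g : sc_hom Cp (c i) d), A i -> g != 0 -> mact (val g) (b i) \in S) ->
  forall y, y \in span_sub A d -> y \in S.
Proof.
move=> AS _ /asboolP[t tA ->].
apply: (@gen_in _ Cp _ _ (res_cmod Cp N)) => i.
have [->|ti] := eqVneq (dcoef t i) 0; first by rewrite mact0l rpred0.
exact: AS (tA i ti) ti.
Qed.

Lemma span_mono (A B : W -> Prop) d y : (forall i, A i -> B i) ->
  y \in span_sub A d -> y \in span_sub B d.
Proof. by move=> AB; apply: span_min => i g /AB Bi _; apply: span_gen. Qed.

Lemma span_plus (A : W -> Prop) d e (g : sc_hom Cp d e) y :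
  y \in span_sub A d -> mact (val g) y \in span_sub A e.
Proof.
pose S := preimage_subspace (mact (val g) : {linear N d -> N e}) (span_sub A e).
apply: (@span_min A d S) => i h Ai _.
rewrite -[_ \in _]/(mact (val g) (mact (val h) (b i)) \in span_sub A e) -mactM.
exact: (span_gen (sc_comp g h)).
Qed.

(** Write the map as a sum of products of [g] and [f] through objects [e] of smaller degree. The
    expansion at [e] of [f] applied to [b j] involves only basis elements of degree at most that of
    [e], and [g] preserves spans. *)
Lemma span_ideal (A : W -> Prop) j d (v : hom (c j) d) :
  (forall i, wo_lt (rdeg R (c i)) (rdeg R (c j)) -> A i) ->
  v \in reedy_ideal (rdeg R (c j)) (c j) d ->
  mact v (b j) \in span_sub A d.
Proof.
move=> jA /asboolP[t ->].
pose S := preimage_subspace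
  (applyr (@mact k C N (c j) d) (b j) : {linear hom (c j) d -> N d}) (span_sub A d).
apply: (pm_comp_ind (S := S)) => -[e /= lt_e] g f.
rewrite -[_ \in _]/(mact (compm (val g) (val f)) (b j) \in span_sub A d) mactM.
apply: span_plus; have [s fb] : exists s, mact (val f) (b j) = phi e s.
  by case: (b_basis e) => h _ hK; exists (h (mact (val f) (b j))); rewrite [RHS]hK.
rewrite fb; apply: (@gen_in _ Cp _ _ (res_cmod Cp N)) => i.
have [->|si] := eqVneq (dcoef s i) 0; first by rewrite mact0l rpred0.
apply: span_gen; apply: jA.
have [->//|ie] := direct_deg (rplus_direct R) si.
exact: wo_lt_trans lt_e.
Qed.

(** The composite of [u] with a coefficient splits into a part in [Cp], which stays in the span by
    construction, and a part in the ideal, covered by [span_ideal]. *)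
Lemma span_act (A : W -> Prop) :
  (forall i j, A j -> wo_lt (rdeg R (c i)) (rdeg R (c j)) -> A i) ->
  forall d e (u : hom d e) y, y \in span_sub A d -> mact u y \in span_sub A e.
Proof.
move=> Adown d e u.
pose S := preimage_subspace (mact u : {linear N d -> N e}) (span_sub A e).
apply: (@span_min A d S) => j g Aj _.
rewrite -[_ \in _]/(mact u (mact (val g) (b j)) \in span_sub A e) -mactM.
have [h hI] := plus_plus_ideal R (compm u (val g)).
rewrite -[compm _ _](subrK (val h)) linearDl rpredD ?span_gen //.
by apply: span_ideal hI => i; apply: Adown.
Qed.

(* The indices of the filtration are W with a greatest element None; the stage s
   is spanned by the b i with i < s, so the step out of Some i adjoins b i. *)
Definition le_top (s t : option W) : bool :=
  match s, t with
  | Some i, Some j => wo_le i j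
  | _, None => true
  | None, Some _ => false
  end.

Lemma le_top_wo : well_order le_top.
Proof.
move=> A [s0 As0].
have [[i0 Ai0]|nA] := pselect (exists i, Some i \in A).
  have [i Ai imin] := wo_min (ex_intro (fun i => Some i \in A) i0 Ai0).
  exists (Some i); split=> [|[j|] [Aj jmin]]; first by split=> // -[j /imin|].
    congr Some; apply: wo_le_anti; last exact: jmin Ai.
    exact: imin.
  by have := jmin _ Ai.
have AN s : s \in A -> s = None by case: s => // i Ai; case: nA; exists i.
have sN := AN _ As0; rewrite sN in As0.
by exists None; split=> [|s [/AN ->]]//; split=> // s /AN ->.
Qed.

Let top_type := WoType le_top_wo.

Let below (s : top_type) (i : W) : Prop := wo_lt (Some i : top_type) s.

Let below_down s i j : below s j -> wo_lt (rdeg R (c i)) (rdeg R (c j)) -> below s i.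
Proof. by move=> js /c_deg ij; apply: wo_lt_trans js. Qed.

Let filt (s : top_type) : submodule N := Submodule (span_act (@below_down s)).

Theorem basis_standard_filtered : standard_filtered R N.
Proof.
exists top_type, filt; split.
  (* The least stage is [None] when [W] is empty, which covers the zero module. *)
  have [bot _ botP] := wo_min (ex_intro (fun s : top_type => True) None I).
  exists bot, None; split=> [s|[]//|d y|d y]; first exact: botP.
    move=> /asboolP[t tbot ->]; rewrite (_ : t = 0) ?linear0 //.
    apply/dsumP => i; apply/eqP; apply: contrapT => /negP/tbot.
    by rewrite /below /wo_lt botP.
  apply/asboolP; case: (b_basis d) => h _ hK.
  by exists (h y); last rewrite [RHS]hK.
split=> [s t st d y|t [[r rt] tlim] d y|s t st].
- by apply: span_mono => i is_; apply: wo_lt_le_trans st.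
- split=> [/asboolP[u ut ->]|[s st]]; last first.
    by apply: span_mono => i is_; apply: wo_lt_trans st.
  (* A combination has finite support, so all its indices lie below one stage before the limit. *)
  have [->|/eqP/(@dsum_max _ _ _ W id)[m um mmax]] := eqVneq u 0.
    by exists r => //; rewrite linear0 rpred0.
  have [s ms st] := tlim _ (ut m um); exists s => //.
  apply/asboolP; exists u => // i /mmax im; exact: (@wo_le_lt_trans top_type (Some m) (Some i) s im ms).
- case: s st => [i|] [st smin]; last by case: t st {smin}.
  exists (c i); apply/subquotient_standardP; exists (b i).
    rewrite -[b i]mact1; exact: (span_gen (A := below t) (sc_id Cp (c i))).
  have I_s d (u : hom (c i) d) : u \in reedy_ideal (rdeg R (c i)) (c i) d ->
      mact u (b i) \in sub_at (filt (Some i)) d.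
    by apply: span_ideal => j /c_deg.
  (* Coefficients are unique, and a combination from the stage [Some i] has coefficient zero at
     [i]. *)
  have g_s d (g : sc_hom Cp (c i) d) :
      mact (val g) (b i) \in sub_at (filt (Some i)) d -> g = 0.
    rewrite -phi_gen => /asboolP[t' t's] /(bij_inj (b_basis d)) gt'.
    rewrite -[g](@dsingleE _ _ (fun j => sc_hom Cp (c j) d)).
    apply/eqP; apply: contrapT => /negP gi.
    have := t's i; rewrite -gt' => /(_ gi).
    by rewrite /below wo_lt_irr.
  split=> [d u|d y /asboolP[u ut ->]].
    split=> [us|]; last exact: I_s.
    have [g ug] := plus_plus_ideal R u.
    have g0 : g = 0.
      apply: g_s; rewrite -[val g](subKr u) linearBl; exact: rpredB (I_s _ _ ug).
    by rewrite g0 subr0 in ug.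
  (* Removing the component at [i] leaves indices below [t] other than [i]. These are below [i],
     since [t] is the successor of [Some i]. *)
  exists (val (dcoef u i)); rewrite -phi_gen -linearB.
  apply: (@gen_in _ Cp _ _ (res_cmod Cp N)) => j; rewrite dsumBE.
  have [<-|ij] := pselect (i = j).
    by rewrite dsingleE subrr mact0l rpred0.
  rewrite dsingle_neq // subr0.
  have [->|uj] := eqVneq (dcoef u j) 0; first by rewrite mact0l rpred0.
  apply: span_gen; have [ji//|/= ij'] := wo_ltNge j i.
  have [//|{}ij'] := wo_le_eqVlt ij'.
  have tj := smin (Some j) ij'.
  have := wo_lt_le_trans (ut j uj) tj; by rewrite wo_lt_irr.
Qed.

End BasisFiltration.

Theorem corollary4p9 (k : fieldType) (C : lincat k) (R : reedy C)
    (M N : cmodule C) :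
  standard_filtered R M -> direct_summand N M -> standard_filtered R N.
Proof.
move=> /standard_filtered_basis[I [c [b b_basis]]] [N' [f [fP fbij]]].
have [g gP gK] := cmod_hom_inv fP fbij.
pose Np := res_cmod (rplus R) N; pose Mp := res_cmod (rplus R) M.
(* The inclusion and projection of the summand, transported along the isomorphism with [M], exhibit
   [N] as a retract. *)
pose iota0 d (x : N d) : M d := f d (x, 0).
pose pi0 d (y : M d) : N d := (g d y).1.
have iota0P d : linear (iota0 d).
  move=> a x y; rewrite /iota0 -linearP; congr (f d _).
  by apply/pair_equal_spec; split; rewrite //= scaler0 addr0.
have pi0P d : linear (pi0 d) by move=> a x y; rewrite /pi0 linearP.
pose iota d : {linear Np d -> Mp d} :=
  HB.pack (iota0 d) (GRing.isLinear.Build _ _ _ _ (iota0 d) (iota0P d)).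
pose pi d : {linear Mp d -> Np d} :=
  HB.pack (pi0 d) (GRing.isLinear.Build _ _ _ _ (pi0 d) (pi0P d)).
have iotaP : cmod_hom (D := rplus R) iota.
  move=> d e u x; rewrite /= /iota0 -[RHS]/(mact (val u) (f d (x, 0))) -fP.
  by congr (f e _); apply/pair_equal_spec; split; rewrite //= linear0.
have piP : cmod_hom (D := rplus R) pi.
  by move=> d e u x; rewrite /= /pi0 [g e _]gP.
have iotaK d : cancel (iota d) (pi d).
  by move=> x; rewrite /= /pi0 /iota0 (gK d).1.
have [J [c' [b' b'_basis]]] :=
  retract_basis (rplus_direct R) iotaP piP iotaK b_basis.
(* The basis index is well-ordered compatibly with the degree, so that initial segments span
   submodules over all of [C]. *)
have [le le_wo le_deg] := well_order_refining (fun j => rdeg R (c' j)).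
apply: (@basis_standard_filtered k C R N (WoType le_wo) c' b' b'_basis) => i j.
by apply: contraNN => /le_deg.
Qed.
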